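(* Let $r\geqslant1$, let $n_1,\dots,n_r\in\mathbb Z$ be pairwise distinct and let $k_1,\dots,k_r$ be positive integers. Then, for every $s\in\mathbb C\setminus\mathbb Z$, $$\frac{1}{(n_1+s)^{k_1}\cdots(n_r+s)^{k_r}}=\sum_{j=1}^{r}\sum_{m_j=0}^{k_j-1}\left(\sum_{\substack{(l_i)_{1\leqslant i\leqslant r,\,i\neq j},\ l_i\geqslant0\\ \sum_{i\neq j}l_i=m_j}}\ \prod_{\substack{1\leqslant i\leqslant r\\i\neq j}}\frac{\binom{-k_i}{l_i}}{(n_i-n_j)^{k_i+l_i}}\right)\frac{1}{(s+n_j)^{k_j-m_j}}.$$
   Context: $\binom{-k}{l}=\frac{(-k)(-k-1)\cdots(-k-l+1)}{l!}$ is the generalized binomial coefficient. When $r=1$, the inner sum over the empty tuple equals $1$ if $m_j=0$ and $0$ if $m_j>0$. *)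

(* Defs.v *)
From HB Require Import structures.
From mathcomp Require Import all_boot all_order all_algebra.
From mathcomp Require Import reals.
From mathcomp Require Import complex.

Set Implicit Arguments.
Unset Strict Implicit.
Unset Printing Implicit Defensive.

Import Order.TTheory GRing.Theory Num.Theory.
Local Open Scope ring_scope.

Definition gbinom (F : numFieldType) (a : F) (l : nat) : F :=
  (\prod_(0 <= i < l) (a - i%:R)) / l`!%:R.

(* Tuples (l_i)_{i != j} of naturals summing to m.  The bound l_i <= m, forced
   by the sum condition, is built into the type so that these tuples form a
   finite set over which one can sum. *)
Definition tuples_sum (r : nat) (j : 'I_r) (m : nat) :
    {set {ffun {i : 'I_r | i != j} -> 'I_m.+1}} :=
  [set l : {ffun {i : 'I_r | i != j} -> 'I_m.+1} | (\sum_i (l i : nat))%N == m].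

(* Main.v *)
Require Import Defs.
From HB Require Import structures.
From mathcomp Require Import all_boot all_order all_algebra.
From mathcomp Require Import reals.
From mathcomp Require Import complex.
From mathcomp Require Import ring.

Set Implicit Arguments.
Unset Strict Implicit.
Unset Printing Implicit Defensive.

Import Order.TTheory GRing.Theory Num.Theory.
Local Open Scope ring_scope.

(** Write [a_i] for the integer [n_i] seen in the field.  After multiplication
    by the common denominator, the claim is the value at [s] of a polynomial
    identity [Q = 1], where [Q] is the sum over [j] of [G_j ('X + a_j)] times
    the product of the [('X + a_i) ^+ k_i] with [i != j], and [G_j] has
    size at most [k_j] and the inner sums of the statement as coefficients.

    [G_j] is the truncation at order [k_j] of the product over [i != j] of the
    binomial series of [('X + (a_i - a_j)) ^- k_i]: a sum over tuples with
    prescribed total is a coefficient of a product of series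
    ([coef_prod_poly]).  So [G_j] times the product of the
    [('X + (a_i - a_j)) ^+ k_i] is [1] modulo ['X^k_j], and the
    substitution of ['X + a_j] for ['X] shows that the [j]-th summand of [Q] is
    [1] modulo [('X + a_j) ^+ k_j] ([local_part_eq1]).  The other summands
    vanish there, hence [Q - 1] is divisible by each of the pairwise coprime
    [('X + a_j) ^+ k_j] and by their product, whose degree is the sum of the
    [k_j].  The degree of [Q - 1] is smaller, so [Q = 1]
    ([sum_local_part_eq1]). *)

(** * Truncated products *)

Lemma take_poly_mulr (F : fieldType) N (p q : {poly F}) :
  take_poly N (p * take_poly N q) = take_poly N (p * q).
Proof. by rewrite !Pdiv.IdomainMonic.take_poly_modp modp_mul. Qed.

Section Truncation.
Variables (F : fieldType) (J : finType).

Lemma take_poly_prod N (p : J -> {poly F}) :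
  take_poly N (\prod_i take_poly N (p i)) = take_poly N (\prod_i p i).
Proof.
elim/big_rec2: _ => // i q q' _ IH.
by rewrite -take_poly_mulr IH take_poly_mulr mulrC take_poly_mulr mulrC.
Qed.

(** Truncating the factors further, at order [m.+1], does not change the
    coefficient of index [m], and makes the expanded product a sum over
    functions with values in ['I_m.+1]. *)
Lemma coef_prod_poly N (c : J -> nat -> F) m : (m < N)%N ->
  (\prod_i \poly_(l < N) c i l)`_m =
  \sum_(l : {ffun J -> 'I_m.+1} | (\sum_i l i)%N == m) \prod_i c i (l i).
Proof.
move=> ltmN.
transitivity ((take_poly m.+1 (\prod_i \poly_(l < N) c i l))`_m).
  by rewrite coef_take_poly ltnSn.
rewrite -take_poly_prod coef_take_poly ltnSn.
rewrite (eq_bigr (fun i => \sum_(l < m.+1) c i l *: 'X^l)); last first.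
  move=> i _; rewrite -poly_def; apply/polyP => l.
  rewrite coef_take_poly !coef_poly; case: ltnP => // ltlm.
  by rewrite (leq_ltn_trans _ ltmN).
rewrite bigA_distr_bigA /= coef_sum [RHS]big_mkcond; apply: eq_bigr => l _.
rewrite scaler_prod -expr_sum coefZ coefXn eq_sym.
by case: ifP => _; rewrite ?mulr1 ?mulr0.
Qed.

End Truncation.

(** * Binomial series of negative powers *)

Section BinomialSeries.
Variable F : numFieldType.
Implicit Types (a b : F) (k l m N : nat).

Lemma gbinom_n0 a : gbinom a 0 = 1.
Proof. by rewrite /gbinom big_geq // fact0 divr1. Qed.

Lemma gbinom_0S l : gbinom (0 : F) l.+1 = 0.
Proof. by rewrite /gbinom big_nat_recl //= subrr !mul0r. Qed.

Lemma gbinom_pascal a l :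
  gbinom (a + 1) l.+1 = gbinom a l.+1 + gbinom a l.
Proof.
rewrite /gbinom big_nat_recl // [in RHS]big_nat_recr //= subr0.
rewrite (eq_bigr (fun i => a - i%:R)); last first.
  by move=> i _; rewrite -natr1 opprD addrACA subrr addr0.
set p := \prod_(0 <= i < l) _.
have f_neq0 : l`!%:R != 0 :> F by rewrite pnatr_eq0 -lt0n fact_gt0.
have l_neq0 : l.+1%:R != 0 :> F by rewrite pnatr_eq0.
rewrite factS natrM.
by field; rewrite f_neq0 addrC natr1 l_neq0.
Qed.

Definition invpow_coef b k l : F := gbinom (- k%:R) l / b ^+ (k + l).

Definition invpow b k N : {poly F} := \poly_(l < N) invpow_coef b k l.

(** Pascal's rule for [gbinom], read on generating functions. *)
Lemma mul_invpowS b k N : b != 0 ->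
  take_poly N (('X + b%:P) * invpow b k.+1 N) = invpow b k N.
Proof.
move=> b0; apply/polyP => m; rewrite coef_take_poly coef_poly.
case: ltnP => // ltmN; rewrite mulrDl coefD coefXM coefCM !coef_poly ltmN.
have kE : - k%:R = - k.+1%:R + 1 :> F by rewrite -natr1 opprD addrNK.
rewrite /invpow_coef kE; case: m ltmN => [_|m ltmN] /=.
  rewrite !gbinom_n0 !addn0 add0r !mul1r exprS invfM mulrA.
  by rewrite mulfV ?mul1r.
rewrite (ltnW ltmN) gbinom_pascal mulrDl addrC.
congr (_ + _); last by rewrite addSnnS.
by rewrite addSn exprS invfM mulrCA mulVKf.
Qed.

(** [invpow b k N] is the truncated series of [('X + b) ^- k]: each factor
    ['X + b] lowers the exponent by one, down to the constant series [1]. *)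
Lemma mul_invpow b k N : b != 0 ->
  take_poly N (('X + b%:P) ^+ k * invpow b k N) = take_poly N 1.
Proof.
move=> b0; elim: k => [|k IHk].
  rewrite mul1r; apply/polyP => m; rewrite !coef_take_poly coef_poly coef1.
  case: ltnP => // _; rewrite /invpow_coef oppr0.
  by case: m => [|m]; rewrite ?gbinom_0S ?mul0r ?gbinom_n0 ?addn0 ?divr1.
by rewrite exprSr -mulrA -take_poly_mulr mul_invpowS.
Qed.

End BinomialSeries.

Lemma mul_prod_invpow (F : numFieldType) (J : finType) (b : J -> F)
    (k : J -> nat) N : (forall i, b i != 0) ->
  take_poly N (\prod_i ('X + (b i)%:P) ^+ k i *
               take_poly N (\prod_i invpow (b i) (k i) N)) = take_poly N 1.
Proof.
move=> b0; rewrite take_poly_mulr -big_split /=.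
rewrite -take_poly_prod (eq_bigr (fun=> take_poly N 1)); last first.
  by move=> i _; rewrite mul_invpow.
by rewrite take_poly_prod big1.
Qed.

(** * Partial fractions *)

Lemma dvdp_coprime_prod (F : fieldType) (I : eqType) (s : seq I)
    (d : I -> {poly F}) (p : {poly F}) : uniq s ->
  {in s &, forall i j, i != j -> coprimep (d i) (d j)} ->
  {in s, forall i, d i %| p} -> \prod_(i <- s) d i %| p.
Proof.
elim: s => [|i s IHs] /=; first by rewrite big_nil dvd1p.
case/andP=> i_s s_uniq cop dvd; rewrite big_cons Gauss_dvdp.
  rewrite dvd ?mem_head // IHs // => [j l js ls|j js].
    by apply: cop; rewrite inE ?js ?ls orbT.
  by apply: dvd; rewrite inE js orbT.
rewrite big_seq; elim/big_rec: _ => [|j q js IH]; first exact: coprimep1.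
rewrite coprimepMr IH andbT cop ?mem_head ?inE ?js ?orbT //.
by apply: contraNneq i_s => ->.
Qed.

Section PartialFractions.
Variables (F : numFieldType) (r : nat) (a : 'I_r -> F) (k : 'I_r -> nat).
Hypothesis a_inj : injective a.

Definition pfrac_coef (j : 'I_r) m : F :=
  \sum_(l in tuples_sum j m)
     \prod_(i : {i : 'I_r | i != j})
        invpow_coef (a (val i) - a j) (k (val i)) (l i).

(** The part of the decomposition carried by the pole [- a j], multiplied by
    the common denominator. *)
Definition local_part (j : 'I_r) : {poly F} :=
  (\poly_(m < k j) pfrac_coef j m \Po ('X + (a j)%:P)) *
  \prod_(i | i != j) ('X + (a i)%:P) ^+ k i.

Lemma pfrac_polyE j :
  \poly_(m < k j) pfrac_coef j m =
  take_poly (k j) (\prod_(i : {i | i != j})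
                     invpow (a (val i) - a j) (k (val i)) (k j)).
Proof.
apply/polyP => m; rewrite coef_take_poly coef_poly; case: ltnP => // ltmk.
by rewrite coef_prod_poly //; apply: eq_bigl => l; rewrite inE.
Qed.

(** Centred at the pole, that is, with ['X] in place of ['X + a j], the other
    factors of the denominator become powers of ['X + (a i - a j)], which
    [pfrac_coef j] inverts up to order [k j] because [a i != a j]. *)
Lemma local_part_eq1 j : ('X + (a j)%:P) ^+ k j %| local_part j - 1.
Proof.
have a_neq (i : {i | i != j}) : a (val i) - a j != 0.
  by rewrite subr_eq0 (inj_eq a_inj) (valP i).
pose P := \prod_(i : {i | i != j}) ('X + (a (val i) - a j)%:P) ^+ k (val i).
pose G := \poly_(m < k j) pfrac_coef j m.
have dvdX : 'X^(k j) %| P * G - 1.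
  have := mul_prod_invpow (fun i : {i | i != j} => k (val i)) (k j) a_neq.
  rewrite -pfrac_polyE -/P -/G !Pdiv.IdomainMonic.take_poly_modp => PG.
  by rewrite /dvdp modpD modpN PG subrr.
have := dvdp_comp_poly ('X + (a j)%:P) dvdX.
rewrite comp_Xn_poly rmorphB rmorphM rmorph1 /= mulrC.
suff -> : P \Po ('X + (a j)%:P) = \prod_(i | i != j) ('X + (a i)%:P) ^+ k i.
  by [].
rewrite big_sub rmorph_prod; apply: eq_bigr => i _.
rewrite rmorphXn rmorphD /= comp_polyX comp_polyC -addrA -polyCD.
by rewrite [a j + _]addrC subrK.
Qed.

Lemma dvdp_local_part i j : i != j ->
  ('X + (a j)%:P) ^+ k j %| local_part i.
Proof.
by move=> ij; rewrite /local_part (bigD1 j) 1?eq_sym //= mulrCA dvdp_mulr.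
Qed.

Lemma size_prod_XaddC_exp (P : pred 'I_r) :
  size (\prod_(i | P i) ('X + (a i)%:P) ^+ k i) = (\sum_(i | P i) k i).+1.
Proof.
have size_exp i : size (('X + (a i)%:P) ^+ k i) = (k i).+1.
  by rewrite -[a i]opprK polyCN size_exp_XsubC.
rewrite size_prod => [|i _]; last by rewrite -size_poly_eq0 size_exp.
under eq_bigr do rewrite size_exp -addn1.
by rewrite big_split /= sum1_card -addSn addnK.
Qed.

Lemma size_local_part j :
  (size (local_part j) <= \sum_i k i)%N.
Proof.
apply: leq_trans (size_polyMleq _ _) _.
rewrite size_prod_XaddC_exp addnS /= [leqRHS](bigD1 j) //= leq_add2r.
by rewrite size_comp_poly2 ?size_XaddC // size_poly.
Qed.

(** The difference of both sides has degree less than that of the common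
    denominator, which divides it: each factor [('X + a j) ^+ k j] divides the
    local parts at the other poles and, by [local_part_eq1], the local part
    at [j] minus [1]. *)
Lemma sum_local_part_eq1 : (0 < \sum_i k i)%N -> \sum_j local_part j = 1.
Proof.
move=> k_gt0; apply/eqP; rewrite -subr_eq0; apply/contraT => Q_neq0.
pose D := \prod_i ('X + (a i)%:P) ^+ k i.
have D_dvd : D %| \sum_j local_part j - 1.
  apply: dvdp_coprime_prod => [|i j _ _ ij|j _]; first exact: index_enum_uniq.
    apply/coprimep_expl/coprimep_expr.
    rewrite -[a i]opprK -[a j]opprK (polyCN (- a i)) (polyCN (- a j)).
    rewrite coprimep_XsubC2 //.
    by rewrite opprK addrC subr_eq0 (inj_eq a_inj).
  rewrite (bigD1 j) //= addrAC dvdp_addr ?local_part_eq1 //.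
  apply: (big_ind (dvdp _)) => [|p q|i]; [exact: dvdp0 | exact: dvdp_add |].
  exact: dvdp_local_part.
have := dvdp_leq Q_neq0 D_dvd; rewrite size_prod_XaddC_exp leqNgt ltnS.
rewrite (leq_trans (size_polyD _ _)) // geq_max size_polyN size_poly1 k_gt0.
rewrite andbT (leq_trans (size_sum _ _ _)) //.
by apply/bigmax_leqP => j _; exact: size_local_part.
Qed.

Lemma partial_fractions (s : F) : (0 < \sum_i k i)%N ->
  (forall i, s + a i != 0) ->
  1 / \prod_i (s + a i) ^+ k i =
  \sum_j \sum_(m < k j) pfrac_coef j m * (1 / (s + a j) ^+ (k j - m)).
Proof.
move=> k_gt0 sa; have pow_neq0 i n : (s + a i) ^+ n != 0 by rewrite expf_neq0.
have D_neq0 : \prod_i (s + a i) ^+ k i != 0 by apply/prodf_neq0.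
apply: (mulIf D_neq0); rewrite divfK //.
rewrite -[LHS](hornerC _ s) -[1%:P](sum_local_part_eq1 k_gt0) horner_sum.
rewrite mulr_suml; apply: eq_bigr => j _.
rewrite /local_part hornerM horner_comp horner_prod horner_poly.
rewrite [in RHS](bigD1 j) //= mulrA [in RHS]mulr_suml; congr (_ * _).
  apply: eq_bigr => m _; rewrite hornerD hornerX hornerC -mulrA; congr (_ * _).
  rewrite -[in X in _ = _ * X](subnK (ltnW (ltn_ord m))) exprD mulrA div1r.
  by rewrite mulVf ?mul1r.
by apply: eq_bigr => i _; rewrite horner_exp hornerD hornerX hornerC.
Qed.

End PartialFractions.

Theorem lemma4p1 (R : realType) (r : nat) (n : 'I_r -> int) (k : 'I_r -> nat)
    (r_ge1 : (1 <= r)%N) (n_distinct : injective n)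
    (k_gt0 : forall i : 'I_r, (0 < k i)%N)
    (s : R[i]) (s_notin_int : ~ exists z : int, s = z%:~R) :
  1 / \prod_(i < r) ((n i)%:~R + s) ^+ k i =
  \sum_(j < r) \sum_(m < k j)
    (\sum_(l in tuples_sum j m)
       \prod_(i : {i : 'I_r | i != j})
          (gbinom (- (k (val i))%:R) (l i)
           / (n (val i) - n j)%:~R ^+ (k (val i) + l i)))
    * (1 / (s + (n j)%:~R) ^+ (k j - m)).
Proof.
pose a (i : 'I_r) : R[i] := (n i)%:~R.
have a_inj : injective a by move=> i j /intr_inj /n_distinct.
have sum_k_gt0 : (0 < \sum_i k i)%N.
  by rewrite (bigD1 (Ordinal r_ge1)) //= ltn_addr.
have s_neq i : s + a i != 0.
  apply/eqP => sa0; apply: s_notin_int; exists (- n i).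
  by rewrite rmorphN; apply/eqP; rewrite -addr_eq0; exact/eqP.
under eq_bigr do rewrite addrC.
rewrite (partial_fractions a_inj sum_k_gt0 s_neq).
apply: eq_bigr => j _; apply: eq_bigr => m _; congr (_ * _).
by apply: eq_bigr => l _; apply: eq_bigr => i _; rewrite rmorphB.
Qed.
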